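(* Let $k\ge 2$ be an integer, $r\in\{1,2,3\}$, $N=3k+r$, and let $n$ be a positive integer with $n\ge 7k+r$. Then there exists a connected trivially perfect graph $G$ with $|V(G)|=n$ that has a true twin partition into $N$ sets, such that the distance matrix of $G$ has nullity $\ell$, where: $\ell=k-1$ if $n=7k+r$, or if $r=1$ and $n\ge 7k+3$; $\ell=k$ if $r=1$ and $n=7k+2$; and $\ell\in\{k-1,k\}$ otherwise.
   Context: All graphs are finite and simple. A graph is trivially perfect if it contains no induced subgraph isomorphic to $P_4$ (path on 4 vertices) or $C_4$ (cycle on 4 vertices). Two vertices $u,v$ are true twins if $N[u]=N[v]$, where $N[v]$ is the closed neighborhood of $v$. A true twin partition of $G$ is a partition of $V(G)$ into sets each consisting of pairwise true twins (singleton sets allowed). The distance matrix of a connected graph has $(i,j)$-entry the shortest-path distance between the $i$-th and $j$-th vertices; its nullity is the dimension of its null space. *)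

(* Defs.v *)
From HB Require Import structures.
From mathcomp Require Import all_boot all_order all_algebra.

Set Implicit Arguments.
Unset Strict Implicit.
Unset Printing Implicit Defensive.

Import GRing.Theory.

Record sgraph := SGraph {
  vertex :> finType;
  edge : rel vertex;
  edge_sym : symmetric edge;
  edge_irrefl : irreflexive edge }.

Arguments edge {s}.

Definition iso (G H : sgraph) : Prop :=
  exists2 f : G -> H, bijective f & forall x y, edge (f x) (f y) = edge x y.

Section Induced.
Variables (G : sgraph) (S : {set G}).

Definition induced_edge : rel {x : G | x \in S} :=
  fun x y => edge (val x) (val y).

Lemma induced_edge_sym : symmetric induced_edge.
Proof. by move=> x y; apply: edge_sym. Qed.

Lemma induced_edge_irrefl : irreflexive induced_edge.
Proof. by move=> x; apply: edge_irrefl. Qed.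

Definition induced : sgraph := SGraph induced_edge_sym induced_edge_irrefl.
End Induced.

Definition P4_edge : rel 'I_4 := fun i j => (i.+1 == j) || (j.+1 == i).

Lemma P4_edge_sym : symmetric P4_edge.
Proof. by move=> i j; rewrite /P4_edge orbC. Qed.

Lemma P4_edge_irrefl : irreflexive P4_edge.
Proof. by case; do 4 case=> //. Qed.

Definition P4 : sgraph := SGraph P4_edge_sym P4_edge_irrefl.

Definition C4_edge : rel 'I_4 :=
  fun i j => (i.+1 %% 4 == j) || (j.+1 %% 4 == i).

Lemma C4_edge_sym : symmetric C4_edge.
Proof. by move=> i j; rewrite /C4_edge orbC. Qed.

Lemma C4_edge_irrefl : irreflexive C4_edge.
Proof. by case; do 4 case=> //. Qed.

Definition C4 : sgraph := SGraph C4_edge_sym C4_edge_irrefl.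

Definition contains_induced (G H : sgraph) : Prop :=
  exists S : {set G}, iso (induced S) H.

Definition trivially_perfect (G : sgraph) : Prop :=
  ~ contains_induced G P4 /\ ~ contains_induced G C4.

Definition connected (G : sgraph) : Prop := forall x y : G, connect edge x y.

Definition closed_nbhd (G : sgraph) (v : G) : {set G} :=
  v |: [set w | edge v w].

Definition true_twins (G : sgraph) (u v : G) : Prop :=
  closed_nbhd u = closed_nbhd v.

Definition true_twin_partition (G : sgraph) (P : {set {set G}}) : Prop :=
  partition P [set: G] /\
  forall B, B \in P -> {in B &, forall u v, true_twins u v}.

(* Length of a shortest walk from x to y; the junk value #|G| is returned when
   y is not reachable from x. *)
Definition dist (G : sgraph) (x y : G) : nat :=
  find (fun d => [exists p : d.-tuple G, path edge x p && (last x p == y)])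
       (iota 0 #|G|).

Lemma dist_le (G : sgraph) (x : G) (p : seq G) :
  path edge x p -> dist x (last x p) <= size p.
Proof.
move=> ep; rewrite leqNgt; apply/negP => lt_p.
have szp : size p < #|G|.
  by apply: leq_trans lt_p _; rewrite /dist -{2}(size_iota 0 #|G|) find_size.
have := before_find 0 lt_p; rewrite nth_iota // add0n => /existsP[].
by exists (in_tuple p); rewrite /= ep eqxx.
Qed.

Lemma dist_path (G : sgraph) (x y : G) : connect edge x y ->
  exists p, [/\ path edge x p, last x p = y & size p = dist x y].
Proof.
move=> /connectP[p0 /shortenP[p ep up _] ->].
have szp : size p < #|G| by rewrite -[(size p).+1](card_uniqP up) max_card.
set a := fun d => [exists q : d.-tuple G, path edge x q && (last x q == last x p)].
have ha : has a (iota 0 #|G|).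
  apply/hasP; exists (size p); first by rewrite mem_iota.
  by apply/existsP; exists (in_tuple p); rewrite /= ep eqxx.
have := nth_find 0 ha; rewrite has_find size_iota in ha.
rewrite nth_iota // add0n => /existsP[q /andP[eq /eqP lq]].
by exists q; split=> //; rewrite size_tuple.
Qed.

Definition dist_mx (R : nzRingType) (G : sgraph) : 'M[R]_#|G| :=
  \matrix_(i, j) ((dist (enum_val i) (enum_val j))%:R)%R.

(* kermx acts on row vectors, so the transpose yields the null space
   {x | A x = 0} of column vectors. *)
Definition nullity (F : fieldType) (m n : nat) (A : 'M[F]_(m, n)) : nat :=
  \rank (kermx A^T).

(* Main.v *)
(* Take u universal vertices, a clique A (possibly empty), and k blocks, each
   made of 3 centres joined to two disjoint copies of K_2.  As the diameter is
   at most 2, x is in the kernel of the distance matrix iff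
   x_v + sum_{N[v]} x = 2 s for every v, where s is the sum of all entries.
   The adjacency matrix of a block has -2 as a simple eigenvalue, with
   eigenvector c on the centres and - c on the leaves, whose sum is - c <> 0;
   hence the equations say that each block carries such a vector, that x
   vanishes on A, that x = sum_i c_i on the universal vertices, and that
   (u - 2) sum_i c_i = 0.  So the nullity is k if u = 2 and k - 1 otherwise,
   independently of A, which is then used to adjust the number of vertices and
   of true twin classes. *)
Require Import Defs.
From HB Require Import structures.
From mathcomp Require Import all_boot all_order all_algebra.
From mathcomp Require Import zify ring lra.

Set Implicit Arguments.
Unset Strict Implicit.
Unset Printing Implicit Defensive.

Import GRing.Theory.

(** * Comparability graphs of the prefix order *)

(** The forest property of the prefix order, which is what excludes [P4] and [C4]. *)
Lemma prefix_comparable (T : eqType) (s1 s2 s : seq T) :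
  prefix s1 s -> prefix s2 s -> prefix s1 s2 || prefix s2 s1.
Proof.
rewrite !prefixE => /eqP s1E /eqP s2E; apply/orP.
case/orP: (leq_total (size s1) (size s2)) => le12.
  by left; rewrite -[in X in take _ X]s2E take_takel // s1E.
by right; rewrite -[in X in take _ X]s1E take_takel // s2E.
Qed.

Section ComparabilityGraph.
Variables (T : eqType) (V : finType) (lab : V -> seq T).

Definition comparable : rel V :=
  fun x y => prefix (lab x) (lab y) || prefix (lab y) (lab x).

Definition comparability_edge : rel V :=
  fun x y => (x != y) && comparable x y.

Lemma comparability_edge_sym : symmetric comparability_edge.
Proof. by move=> x y; rewrite /comparability_edge /comparable eq_sym orbC. Qed.

Lemma comparability_edge_irrefl : irreflexive comparability_edge.
Proof. by move=> x; rewrite /comparability_edge eqxx. Qed.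

Definition comparability_graph : sgraph :=
  SGraph comparability_edge_sym comparability_edge_irrefl.

Lemma in_closed_nbhd_comparability (x y : comparability_graph) :
  (y \in closed_nbhd x) = comparable x y.
Proof.
rewrite !inE /edge /= /comparability_edge eq_sym.
by case: eqP => //= ->; rewrite /comparable prefix_refl.
Qed.

Lemma true_twins_comparability (x y : comparability_graph) :
  lab x = lab y -> true_twins x y.
Proof.
by move=> eq_xy; apply/setP => z;
  rewrite !in_closed_nbhd_comparability /comparable eq_xy.
Qed.

(** If [lab b] is a prefix of [lab c], then [b] and [d] are comparable: by transitivity, or as two
    prefixes of [lab c]. The other case is symmetric, with [a] and [c]. *)
Lemma comparability_path_chord (a b c d : comparability_graph) :
  edge a b -> edge b c -> edge c d -> a != c -> b != d ->
  edge a c || edge b d.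
Proof.
rewrite /edge /= /comparability_edge /comparable.
move=> /andP[_ ab] /andP[_ bc] /andP[_ cd] -> -> /=.
case/orP: bc => bc.
  case/orP: cd => cd; first by rewrite (prefix_trans bc cd) !orbT.
  by rewrite (prefix_comparable bc cd) orbT.
case/orP: ab => ab; last by rewrite (prefix_trans bc ab) !orbT.
by rewrite (prefix_comparable ab bc).
Qed.

Lemma trivially_perfect_comparability : trivially_perfect comparability_graph.
Proof.
pose o i (lt_i : i < 4) : 'I_4 := Ordinal lt_i.
(* In [P4] and in [C4], 0, 1, 2, 3 is a path with 0, 2 and 1, 3 nonadjacent, so one argument covers
   both. *)
suff no_path (H : sgraph) (a b c d : H) :
    edge a b -> edge b c -> edge c d -> a != c -> b != d ->
    ~~ edge a c -> ~~ edge b d -> ~ contains_induced comparability_graph H.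
  split.
    by apply: (no_path P4 (o 0 isT) (o 1 isT) (o 2 isT) (o 3 isT)).
  by apply: (no_path C4 (o 0 isT) (o 1 isT) (o 2 isT) (o 3 isT)).
move=> ab bc cd nac nbd neac nebd [S [f [g fK gK] f_edge]].
have eE x y : edge (val (g x)) (val (g y)) = edge x y.
  by rewrite -[in RHS](gK x) -[in RHS](gK y) f_edge.
have nE x y : (val (g x) != val (g y)) = (x != y).
  by rewrite (inj_eq val_inj) (can_eq gK).
have := @comparability_path_chord (val (g a)) (val (g b)) (val (g c)) (val (g d)).
rewrite !eE !nE => /(_ ab bc cd nac nbd).
by rewrite (negbTE neac) (negbTE nebd).
Qed.

(** The sets are the fibres of [f], nonempty and distinct by surjectivity. They may be finer than
    the label classes, which lets their number be tuned. *)
Lemma true_twin_partition_comparability (B : finType) (f : V -> B) :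
  (forall y, exists x, f x = y) ->
  (forall x y, f x = f y -> lab x = lab y) ->
  exists2 P : {set {set comparability_graph}},
    true_twin_partition P & #|P| = #|B|.
Proof.
move=> f_surj f_lab.
pose fib y : {set comparability_graph} := [set x | f x == y].
have fib_inj : injective fib.
  move=> y1 y2 /setP eq12; have [x fx] := f_surj y1.
  by have := eq12 x; rewrite !inE fx eqxx => /esym /eqP.
exists (fib @: [set: B]); last by rewrite card_imset // cardsT.
split.
  apply/and3P; split.
  - rewrite eqEsubset subsetT; apply/subsetP => x _.
    by apply/bigcupP; exists (fib (f x)); rewrite ?imset_f ?inE.
  - apply/trivIsetP => _ _ /imsetP[y1 _ ->] /imsetP[y2 _ ->].
    apply: contraR => /pred0Pn[x /andP[]] /=.
    by rewrite !inE => /eqP -> /eqP ->.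
  - apply/imsetP => -[y _ /setP eq0]; have [x fx] := f_surj y.
    by have := eq0 x; rewrite !inE fx eqxx.
move=> _ /imsetP[y _ ->] u v; rewrite !inE => /eqP fu /eqP fv.
by apply: true_twins_comparability; apply: f_lab; rewrite fu fv.
Qed.

End ComparabilityGraph.

(** * Distances in the presence of a universal vertex *)

Section UniversalVertex.
Variables (G : sgraph) (z : G).
Hypothesis z_univ : forall x, x != z -> edge z x.

Lemma connected_universal : connected G.
Proof.
have zx x : connect edge z x.
  by have [-> | /z_univ/connect1] := eqVneq x z; rewrite ?connect0.
move=> x y; apply: connect_trans (zx y).
by rewrite (sym_connect_sym (@edge_sym G)).
Qed.

(** The walk through [z] bounds distances by 2; as [x] lies in its own closed neighbourhood,
    equality contributes two units and adjacency one. *)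
Lemma dist_universal (x y : G) :
  (dist x y + (x == y) + (y \in closed_nbhd x) = 2)%N.
Proof.
rewrite !inE eq_sym.
have [p [ep lp p_dist]] := dist_path (connected_universal x y).
have [<- | neq_xy] := eqVneq x y.
  by have := @dist_le G x [::] isT; rewrite leqn0 => /eqP /= ->.
have dist_gt0 : 0 < dist x y.
  by rewrite -p_dist; case: p lp {ep p_dist} neq_xy => //= ->; rewrite eqxx.
case xy: (edge x y) => /=.
  by have := @dist_le G x [:: y]; rewrite /= xy => /(_ isT); lia.
have dist_gt1 : 1 < dist x y.
  rewrite -p_dist; case: p lp ep {p_dist} neq_xy => [|w [|? ?]] //=.
    by move=> ->; rewrite eqxx.
  by move=> ->; rewrite xy.
have nxz : x != z.
  apply: contraNneq (negbT xy) => xz.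
  by move: neq_xy; rewrite xz eq_sym => /z_univ->.
have nyz : y != z.
  by apply: contraNneq (negbT xy) => ->; rewrite edge_sym z_univ.
have := @dist_le G x [:: z; y].
by rewrite /= (z_univ nyz) edge_sym (z_univ nxz) => /(_ isT); lia.
Qed.

Local Open Scope ring_scope.

(** This is D = 2J - I - (I + Adj) applied to [f], with J the all-ones matrix. *)
Lemma dist_sum_universal (R : comNzRingType) (f : G -> R) (x : G) :
  \sum_y f y * (dist x y)%:R =
    2 * \sum_y f y - f x - \sum_(y in closed_nbhd x) f y.
Proof.
have distE y : (dist x y)%:R = 2 - (x == y)%:R - (y \in closed_nbhd x)%:R :> R.
  by rewrite -[2](congr1 (fun n : nat => n%:R) (dist_universal x y)) !natrD; ring.
under eq_bigr do rewrite distE !mulrBr.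
rewrite !sumrB -mulr_suml mulrC; congr (_ - _ - _).
  by rewrite (bigD1 x) //= eqxx mulr1 big1 ?addr0 // => y /negPf;
    rewrite eq_sym => ->; rewrite mulr0.
by rewrite [RHS]big_mkcond; apply: eq_bigr => y _;
  case: ifP => _; rewrite ?mulr1 ?mulr0.
Qed.

End UniversalVertex.

(** * Kernels as linear systems *)

Section DistanceKernel.
Variables (R : fieldType) (G : sgraph).
Local Open Scope ring_scope.

Lemma sub_ker_dist_mx (x : 'rV[R]_#|G|) :
  (x <= kermx (dist_mx R G)^T)%MS =
    [forall v : G, \sum_w x 0 (enum_rank w) * (dist v w)%:R == 0].
Proof.
have xE v : (x *m (dist_mx R G)^T) 0 (enum_rank v) =
    \sum_w x 0 (enum_rank w) * (dist v w)%:R.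
  rewrite mxE (reindex_onto enum_rank enum_val) /=; last first.
    by move=> i _; exact: enum_valK.
  by apply: eq_big => [w | w _]; rewrite ?enum_rankK ?eqxx // !mxE !enum_rankK.
apply/sub_kermxP/forallP => [x0 v | x0]; first by rewrite -xE x0 mxE.
apply/rowP => i; rewrite -(enum_valK i) xE mxE; exact/eqP.
Qed.

End DistanceKernel.

(** A nonzero [a] cuts out the hyperplane of zero-sum row vectors, costing one dimension. *)
Lemma mxrank_ker_const (F : fieldType) (k : nat) (a : F) : 0 < k ->
  \rank (kermx (const_mx a : 'cV_k)) = k - (a != 0)%R.
Proof.
move=> k_gt0; rewrite mxrank_ker -mxrank_tr rank_rV; congr (k - ~~ _).
apply/eqP/eqP => [/rowP/(_ (Ordinal k_gt0)) | ->]; first by rewrite !mxE.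
by apply/rowP => i; rewrite !mxE.
Qed.

(** * The block graph *)

Section BlockGraph.
Variables (k : nat) (U A : finType).
Local Open Scope ring_scope.

Definition block_vertex : finType := (U + A + 'I_k * 'I_7)%type.

(* In a block, the vertices 0, 1, 2 are the centres, and {3, 4} and {5, 6} are
   the two leaf cliques. *)
Definition block_class (j : 'I_7) : seq nat :=
  nth [::] [:: [::]; [::]; [::]; [:: 0]; [:: 0]; [:: 1]; [:: 1]] j.

(** The empty word is a prefix of every label. Distinct first letters, 0 for [A] and [i + 1] for
    block [i], keep the other components incomparable. *)
Definition block_label (v : block_vertex) : seq nat :=
  match v with
  | inl (inl _) => [::]
  | inl (inr _) => [:: 0]
  | inr (i, j) => (val i).+1 :: block_class j
  end.

Definition block_graph : sgraph := comparability_graph block_label.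

Lemma card_block_graph : #|block_graph| = (#|U| + #|A| + k * 7)%N.
Proof. by rewrite !card_sum card_prod !card_ord. Qed.

Lemma block_graph_universal (z : U) (v : block_graph) :
  v != inl (inl z) -> edge (inl (inl z) : block_graph) v.
Proof.
by move=> nvz; rewrite /edge /= /comparability_edge eq_sym nvz /comparable prefix0s.
Qed.

Lemma big_block_vertex (R : nmodType) (P : pred block_vertex)
    (f : block_vertex -> R) :
  \sum_(v | P v) f v =
    \sum_(a | P (inl (inl a))) f (inl (inl a))
    + \sum_(a | P (inl (inr a))) f (inl (inr a))
    + \sum_i \sum_(j | P (inr (i, j))) f (inr (i, j)).
Proof.
rewrite !big_sumType pair_big_dep /=; congr (_ + _).
by apply: eq_big => [[i j]|[i j]].
Qed.

Lemma block_labels_comparable (i i' : 'I_k) (j j' : 'I_7) :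
  comparable block_label (inr (i, j)) (inr (i', j')) =
    (i == i') && comparable block_class j j'.
Proof.
by rewrite /comparable /= !eqSS (eq_sym (val i')) -andb_orr.
Qed.

(** * Solving the kernel equations *)

Variable R : realFieldType.
Implicit Types (f : block_graph -> R) (c : 'I_k -> R).

Definition block_vector c (v : block_vertex) : R :=
  match v with
  | inl (inl _) => \sum_i c i
  | inl (inr _) => 0
  | inr (i, j) => if (j < 3)%N then c i else - c i
  end.

Lemma eq_block_vector c c' : c =1 c' -> block_vector c =1 block_vector c'.
Proof.
move=> eq_c [[a | a] | [i j]] //=; last by rewrite eq_c.
by apply: eq_bigr => i _; apply: eq_c.
Qed.

(** By [dist_sum_universal], the entry at [v] of the distance matrix applied to [f], once [U] is
    inhabited. *)
Definition block_gap (f : block_graph -> R) (v : block_graph) : R :=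
  2 * \sum_w f w - f v - \sum_(w in closed_nbhd v) f w.

Lemma closed_nbhd_sum_U f (a : U) :
  \sum_(w in closed_nbhd (inl (inl a) : block_graph)) f w = \sum_w f w.
Proof.
by apply: eq_bigl => w; rewrite in_closed_nbhd_comparability /comparable prefix0s.
Qed.

Lemma closed_nbhd_sum_A f (a : A) :
  \sum_(w in closed_nbhd (inl (inr a) : block_graph)) f w =
    \sum_b f (inl (inl b)) + \sum_b f (inl (inr b)).
Proof.
under eq_bigl do rewrite in_closed_nbhd_comparability.
rewrite big_block_vertex /comparable /= [X in _ + X]big1 ?addr0 //.
by move=> i _; rewrite big_pred0.
Qed.

Lemma closed_nbhd_sum_block f (i : 'I_k) (j : 'I_7) :
  \sum_(w in closed_nbhd (inr (i, j) : block_graph)) f w =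
    \sum_b f (inl (inl b))
    + \sum_(j' | comparable block_class j j') f (inr (i, j')).
Proof.
under eq_bigl do rewrite in_closed_nbhd_comparability.
rewrite big_block_vertex /= [X in _ + X + _]big_pred0 // addr0; congr (_ + _).
under eq_bigr do under eq_bigl do rewrite block_labels_comparable.
rewrite (bigD1 i) //= eqxx [X in _ + X]big1 ?addr0 // => i' /negPf ni'.
by rewrite big_pred0 // => j'; rewrite eq_sym ni'.
Qed.

(** Seven explicit terms, so that [lra] can treat the block equations. *)
Lemma sum_ord7 (P : pred 'I_7) (g : 'I_7 -> R) :
  let t n := if P (inord n) then g (inord n) else 0 in
  \sum_(j | P j) g j = t 0%N + t 1%N + t 2%N + t 3%N + t 4%N + t 5%N + t 6%N.
Proof.
move=> t; rewrite big_mkcond (eq_bigr (fun j : 'I_7 => t j)) => [|j _].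
  by rewrite !big_ord_recr big_ord0 /= add0r.
by rewrite /t inord_val.
Qed.

Lemma block_sumE (g : 'I_7 -> R) (j : nat) : (j < 7)%N ->
  let x n := g (inord n) in
  \sum_(j' | comparable block_class (inord j) j') g j' =
  if (j < 3)%N then x 0%N + x 1%N + x 2%N + x 3%N + x 4%N + x 5%N + x 6%N
  else if (j < 5)%N then x 0%N + x 1%N + x 2%N + x 3%N + x 4%N
  else x 0%N + x 1%N + x 2%N + x 5%N + x 6%N.
Proof.
move=> lt_j x; rewrite sum_ord7 /comparable /block_class !inordK //.
by do 7![case: j lt_j => [|j] lt_j; first by rewrite /= ?addr0].
Qed.

Lemma block_gap_eq0 f : (0 < k)%N ->
  (forall v, block_gap f v = 0) <->
  exists2 c, f =1 block_vector c & (#|U|%:R - 2) * \sum_i c i = 0.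
Proof.
move=> k_gt0; split=> [gap0 | [c fE c0] v].
  set S := \sum_w f w in gap0 *.
  have fU a : f (inl (inl a)) = S.
    have := gap0 (inl (inl a)); rewrite /block_gap closed_nbhd_sum_U -/S; lra.
  have sumU : \sum_b f (inl (inl b)) = #|U|%:R * S.
    by under eq_bigr do rewrite fU; rewrite sumr_const mulr_natl.
  pose x i n := f (inr (i, inord n)).
  pose c i := x i 0%N.
  (* On a block the equations read (Adj + 2I) x = (2 - |U|) S 1. Pairing with the eigenvector (1, 1,
     1, -1, -1, -1, -1) for -2, of sum -1, kills the right side, so [x] is a multiple of it. *)
  have block i : (forall j : 'I_7, f (inr (i, j)) = if (j < 3)%N then c i else - c i)
      /\ (2 - #|U|%:R) * S = 0.
    have gapE n : (n < 7)%N -> block_gap f (inr (i, inord n)) = 0 by [].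
    have := (gapE 0%N isT, gapE 1%N isT, gapE 2%N isT, gapE 3%N isT,
             gapE 4%N isT, gapE 5%N isT, gapE 6%N isT).
    rewrite /block_gap !closed_nbhd_sum_block !block_sumE //= sumU -/S.
    rewrite -!/(x _ _) mulrBl.
    (* Abstracting the product makes the seven equations linear. *)
    move: (#|U|%:R * S) => y [[[[[[e0 e1] e2] e3] e4] e5] e6].
    split; last by lra.
    have xE n (lt_n : (n < 7)%N) : x i n = if (n < 3)%N then c i else - c i.
      by rewrite /c; do 7![case: n lt_n => [|n] lt_n; first by rewrite /=; lra].
    by move=> j; rewrite -{1}(inord_val j) -/(x _ _) xE.
  have c0 : (2 - #|U|%:R) * S = 0 := (block (Ordinal k_gt0)).2.
  have sum_block i : \sum_j f (inr (i, j)) = - c i.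
    under eq_bigr do rewrite (block i).1.
    by rewrite sum_ord7 /= !inordK //=; lra.
  (* As (2 - |U|) S = 0, each entry on [A] is [- T]; summing gives T (1 + |A|) = 0, and 1 + |A| is
     nonzero in an ordered field. *)
  have sumA : forall a, f (inl (inr a)) = 0.
    set T := \sum_a f (inl (inr a)).
    have fA a : f (inl (inr a)) = - T.
      have := gap0 (inl (inr a)).
      rewrite /block_gap closed_nbhd_sum_A sumU -/S -/T.
      by move: c0; rewrite mulrBl; lra.
    have T0 : T * (1 + #|A|%:R) = 0.
      rewrite mulrDr mulr1 {1}/T (eq_bigr (fun=> - T)) // sumr_const.
      by rewrite mulNrn mulr_natr addNr.
    move=> a; rewrite fA; move/eqP: T0; rewrite mulf_eq0.
    case/orP=> [/eqP -> | ]; first exact: oppr0.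
    by rewrite -[1]/(1%:R) -natrD Num.Theory.pnatr_eq0.
  have sumS : S = \sum_i c i.
    have : S = #|U|%:R * S - \sum_i c i.
      rewrite {1}/S big_block_vertex /= sumU [X in _ + X + _]big1 // addr0 -sumrN.
      by congr (_ + _); apply: eq_bigr => i _; apply: sum_block.
    by move: c0; rewrite mulrBl; lra.
  exists c; last by rewrite -sumS -opprB mulNr c0 oppr0.
  by case=> [[a | a] | [i j]] /=; rewrite ?fU ?sumA ?(block i).1.
(* Converse: the total is |U| t - t, which the constraint turns into [t], the value on the universal
   vertices. *)
set t := \sum_i c i in c0.
have sumU : \sum_b f (inl (inl b)) = #|U|%:R * t.
  by under eq_bigr do rewrite fE; rewrite sumr_const mulr_natl.
have sumA : \sum_b f (inl (inr b)) = 0 by apply: big1 => b _; rewrite fE.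
have sumS : \sum_w f w = #|U|%:R * t - t.
  rewrite big_block_vertex /= sumU sumA addr0 -sumrN; congr (_ + _).
  apply: eq_bigr => i _; under eq_bigr do rewrite fE /=.
  by rewrite sum_ord7 /= !inordK //=; lra.
move: c0; rewrite mulrBl /block_gap sumS => c0.
case: v => [[a | a] | [i j]].
- by rewrite closed_nbhd_sum_U sumS fE /= -/t; lra.
- by rewrite closed_nbhd_sum_A sumU sumA fE /=; lra.
rewrite closed_nbhd_sum_block sumU -(inord_val j) block_sumE // !fE /= !inordK //=.
by case: ifP => lt3; [|case: ifP]; lra.
Qed.

(** * Dimension of the kernel *)

(** The matrix of the linear map [block_vector], acting on rows of parameters. *)
Definition block_kernel_mx : 'M[R]_(k, #|block_graph|) :=
  \matrix_(i, j) block_vector (fun i' => (i' == i)%:R) (enum_val j).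

Lemma mul_block_kernel_mx (c : 'rV[R]_k) (v : block_graph) :
  (c *m block_kernel_mx) 0 (enum_rank v) = block_vector (c 0) v.
Proof.
have sum_delta i : \sum_i' c 0 i' * (i == i')%:R = c 0 i.
  rewrite (bigD1 i) //= eqxx mulr1 big1 ?addr0 // => i' /negPf.
  by rewrite eq_sym => ->; rewrite mulr0.
rewrite mxE; under eq_bigr do rewrite mxE enum_rankK.
case: v => [[a | a] | [i j]] /=.
- apply: eq_bigr => i _; rewrite (bigD1 i) //= eqxx big1 ?addr0 ?mulr1 //.
  by move=> i' /negPf ->.
- by rewrite big1 // => i _; rewrite mulr0.
case: ifP => _; first exact: sum_delta.
by under eq_bigr do rewrite mulrN; rewrite sumrN sum_delta.
Qed.

(** The entry at centre 0 of each block recovers its parameter. *)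
Lemma block_kernel_mx_free : row_free block_kernel_mx.
Proof.
rewrite -kermx_eq0; apply/eqP; apply/row_matrixP => i; rewrite row0.
set c := row i _; apply/rowP => i'.
have /sub_kermxP c0 : (c <= kermx block_kernel_mx)%MS by apply: row_sub.
have := mul_block_kernel_mx c (inr (i', ord0)).
by rewrite c0 !(mxE const_mx_key) /= => <-.
Qed.

Lemma nullity_dist_block_graph (z : U) : (0 < k)%N ->
  nullity (dist_mx R block_graph) = (k - (#|U| != 2))%N.
Proof.
move=> k_gt0.
(* [K] holds the parameters meeting the scalar constraint; the injective parametrization preserves
   its rank. *)
pose K := kermx (const_mx (#|U|%:R - 2) : 'cV[R]_k).
suff eqK : (kermx (dist_mx R block_graph)^T == K *m block_kernel_mx)%MS.
  rewrite /nullity (eqmxP eqK) mxrankMfree ?block_kernel_mx_free //.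
  by rewrite mxrank_ker_const // subr_eq0 Num.Theory.eqr_nat.
have in_K (c : 'rV_k) : (c <= K)%MS = ((#|U|%:R - 2) * \sum_i c 0 i == 0).
  have cE : (c *m (const_mx (#|U|%:R - 2) : 'cV_k)) 0 0 =
      (#|U|%:R - 2) * \sum_i c 0 i.
    by rewrite mxE mulr_sumr; apply: eq_bigr => i _; rewrite mxE mulrC.
  apply/sub_kermxP/eqP => [c0 | c0]; first by rewrite -cE c0 mxE.
  by apply/rowP => i; rewrite ord1 cE mxE.
apply/rV_eqP => u; rewrite sub_ker_dist_mx.
pose f (v : block_graph) := u 0 (enum_rank v).
have gapE v : \sum_w f w * (dist v w)%:R = block_gap f v.
  apply: dist_sum_universal (inl (inl z) : block_graph) _ _ _ _.
  exact: block_graph_universal.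
apply/forallP/idP => [u0 | /submxP[D uE] v].
  have [|c fE c0] := (block_gap_eq0 f k_gt0).1.
    by move=> v; rewrite -gapE; apply/eqP.
  have -> : u = (\row_i c i) *m block_kernel_mx.
    apply/rowP => j; rewrite -(enum_valK j) mul_block_kernel_mx -/(f _) fE.
    by apply: eq_block_vector => i; rewrite mxE.
  apply: submxMr; rewrite in_K -[X in _ == X]c0; apply/eqP; congr (_ * _).
  by apply: eq_bigr => i _; rewrite mxE.
rewrite gapE; apply/eqP; apply: (block_gap_eq0 f k_gt0).2; exists ((D *m K) 0).
  by move=> w; rewrite /f uE mulmxA mul_block_kernel_mx.
by apply/eqP; rewrite -in_K submxMl.
Qed.

End BlockGraph.

(** * Twin partitions and choice of parameters *)

(** Three sets per block (centres and two leaf pairs), one for [U], and the fibres of [g], which cut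
    the twin class [A] at will. *)
Lemma true_twin_partition_block_graph (k : nat) (U A B : finType) (z : U)
    (g : A -> B) :
  (forall b, exists a, g a = b) ->
  exists2 P : {set {set block_graph k U A}},
    true_twin_partition P & #|P| = 3 * k + #|B|.+1.
Proof.
move=> g_surj; pose cls (j : 'I_7) : 'I_3 := inord ((2 < j) + (4 < j)).
pose f (v : block_vertex k U A) : (unit + B + 'I_k * 'I_3)%type :=
  match v with
  | inl (inl _) => inl (inl tt)
  | inl (inr a) => inl (inr (g a))
  | inr (i, j) => inr (i, cls j)
  end.
have cls_class j : block_class j = nth [::] [:: [::]; [:: 0]; [:: 1]] (cls j).
  rewrite /cls /block_class inordK; last by case: (2 < j); case: (4 < j).
  by case: j; do 7 case=> //.
have -> : 3 * k + #|B|.+1 = #|{: unit + B + 'I_k * 'I_3}|.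
  by rewrite !card_sum card_prod !card_ord card_unit; lia.
apply: (@true_twin_partition_comparability _ _ _ _ f).
  case=> [[[] | b] | [i c]]; first by exists (inl (inl z)).
    by have [a <-] := g_surj b; exists (inl (inr a)).
  (* Vertices 1, 3, 5 represent the three classes of a block. *)
  exists (inr (i, inord (2 * c).+1)); congr (inr (_, _)); apply: val_inj.
  by rewrite /cls /= !inordK; case: c; do 3 case=> //.
move=> [[a | a] | [i j]] [[a' | a'] | [i' j']] //= [-> eq_cls].
by rewrite !cls_class eq_cls.
Qed.

Lemma block_graph_exists (R : realFieldType) (k u : nat) (A B : finType)
    (g : A -> B) :
  0 < k -> 0 < u -> (forall b, exists a, g a = b) ->
  exists G : sgraph,
    [/\ connected G, trivially_perfect G, #|G| = 7 * k + u + #|A|,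
        exists2 P : {set {set G}}, true_twin_partition P & #|P| = 3 * k + #|B|.+1
      & nullity (dist_mx R G) = k - (u != 2)].
Proof.
move=> k_gt0 u_gt0 g_surj; pose z : 'I_u := Ordinal u_gt0.
exists (block_graph k 'I_u A); split.
- exact: connected_universal (@block_graph_universal k _ A z).
- exact: trivially_perfect_comparability.
- by rewrite card_block_graph card_ord; lia.
- exact: (true_twin_partition_block_graph k z g_surj).
- by rewrite (@nullity_dist_block_graph k 'I_u A R z) // card_ord.
Qed.

Theorem theorem11 (R : realFieldType) (k r N n l : nat)
  (hk : 2 <= k) (hr : r \in [:: 1; 2; 3]) (hN : N = 3 * k + r)
  (hn0 : 0 < n) (hn : 7 * k + r <= n)
  (hl : if (n == 7 * k + r) || ((r == 1) && (7 * k + 3 <= n)) then l = k - 1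
        else if (r == 1) && (n == 7 * k + 2) then l = k
        else l = k - 1 \/ l = k) :
  exists G : sgraph,
    [/\ connected G, trivially_perfect G, #|G| = n,
        exists2 P : {set {set G}}, true_twin_partition P & #|P| = N
      & nullity (dist_mx R G) = l].
Proof.
have k_gt0 : 0 < k by apply: ltnW.
have r_gt0 : 0 < r by case: (r) hr.
have [r1 | r_neq1] := eqVneq r 1.
  (* For [r = 1] take [A] empty: all n - 7k remaining vertices are universal, and they are two
     exactly when n = 7k + 2. *)
  have u_gt0 : 0 < n - 7 * k by lia.
  have id_surj (b : void) : exists a, id a = b by exists b.
  have [G [conG tpG cardG twG nulG]] := block_graph_exists R k_gt0 u_gt0 id_surj.
  rewrite card_void in cardG twG; exists G; split=> //; [lia | by rewrite hN r1 |].
  rewrite {}nulG; move: hl; case: ifP => [|?]; [|case: ifP]; lia.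
(* For [r > 1], [u = 1] gives k - 1 and [u = 2] gives k. The latter needs n > 7k + r, which holds
   since n = 7k + r forces l = k - 1. *)
have [u [u_gt0 le_un ->]] : exists u,
    [/\ 0 < u, 7 * k + u + r.-1 <= n & l = k - (u != 2)].
  have [lk | lk] : l = k - 1 \/ l = k.
      by move: hl; case: ifP => [|?]; [|case: ifP]; lia.
    by exists 1; split=> //=; lia.
  exists 2; split=> //=; last by rewrite subn0.
  by move: hl; case: ifP => [|?]; [|case: ifP]; lia.
(* The other [m] vertices form [A], to be cut into [r.-1] nonempty sets. *)
pose m := n - 7 * k - u.
suff [B [g g_surj cardB]] : exists B : finType,
    exists2 g : 'I_m -> B, forall b, exists a, g a = b & #|B| = r.-1.
  have [G [conG tpG cardG twG nulG]] := block_graph_exists R k_gt0 u_gt0 g_surj.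
  exists G; split=> //; first by rewrite cardG card_ord; lia.
  by have -> : N = 3 * k + #|B|.+1 by lia.
have [r2 | r3] : r = 2 \/ r = 3.
  by move: hr r_neq1; rewrite !inE => /or3P[] /eqP ->; auto.
  have m_gt0 : 0 < m by lia.
  exists unit, (fun=> tt); last by rewrite r2 card_unit.
  by case; exists (Ordinal m_gt0).
have m_gt1 : 1 < m by lia.
(* Vertex 0 of [A] against the rest, nonempty as [m > 1]. *)
exists bool, (fun a => 0 < a); last by rewrite r3 card_bool.
by case; [exists (Ordinal m_gt1) | exists (Ordinal (ltnW m_gt1))].
Qed.
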